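(* Let $V\in\mathbb{R}^{m\times n}_+$ and consider the KL NMF problem $\min_{W\in\mathbb{R}^{m\times r}_+,\,H\in\mathbb{R}^{r\times n}_+}D(V|WH)$. The objective function $D(V|WH)$ is non-increasing under the updates of the scalar Newton-type (SN) algorithm described in the context: every update of a single entry of $W$ or $H$ performed by the algorithm does not increase $D(V|WH)$.
   Context: $D(V|WH)=\sum_{i=1}^m\sum_{j=1}^n\big((WH)_{ij}-V_{ij}\log (WH)_{ij}\big)+\sum_{i=1}^m\sum_{j=1}^n\big(V_{ij}\log V_{ij}-V_{ij}\big)$ is the Kullback-Leibler divergence, with the conventions $0\times\log0=0$ and $a\times\log 0=-\infty$ for $a>0$. SN algorithm: start from $W>0$, $H>0$ (entrywise). Let $$\mathbf c_{W_{ik}}=\max_{\{l\,|\,V_{il}>0\}}\frac1{\sqrt{V_{il}}},\qquad \mathbf c_{H_{kj}}=\max_{\{l\,|\,V_{lj}>0\}}\frac1{\sqrt{V_{lj}}}.$$ Repeatedly, alternately update each scalar entry of $W$ and $H$ (each possibly several times in a row), the other entries being fixed at their latest values. The update of $W_{ik}$ is as follows. Compute $$f'_{W_{ik}}=\sum_{l=1}^nH_{kl}-\sum_{l=1}^nV_{il}\frac{H_{kl}}{(WH)_{il}},\qquad f''_{W_{ik}}=\sum_{l=1}^nV_{il}\frac{H_{kl}^2}{(WH)_{il}^2}$$ (terms with $V_{il}=0$ in the sums involving $V_{il}$ being $0$), and, for $f''_{W_{ik}}>0$, set $$s=\max\Big\{W_{ik}-\frac{f'_{W_{ik}}}{f''_{W_{ik}}},\,0\Big\},\qquad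 d=s-W_{ik},\qquad \lambda=\mathbf c_{W_{ik}}\sqrt{f''_{W_{ik}}}\,|d|.$$ If $f'_{W_{ik}}\le0$ or $\lambda\le0.683802$, then set $W_{ik}\leftarrow s$ (full proximal Newton step); otherwise set $W_{ik}\leftarrow W_{ik}+\frac1{1+\lambda}d$ (damped step). The update of $H_{kj}$ is the same by symmetry, i.e. with $(V,W,H)$ replaced by $(V^\top,H^\top,W^\top)$. An entry is updated only when its second derivative $f''$ is positive, so that the step is well defined. *)

(* Defs.v *)
From mathcomp Require Import all_boot all_order all_algebra.
From mathcomp Require Import all_classical all_reals all_analysis.

Set Implicit Arguments.
Unset Strict Implicit.
Unset Printing Implicit Defensive.

Import Order.TTheory GRing.Theory Num.Theory.
Local Open Scope ring_scope.

(* The logarithm is the extended-real [lne], so [lne 0 = -oo]; together with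
   [0 * -oo = 0] in [\bar R] this gives 0 log 0 = 0 and a log 0 = -oo (a > 0).
   No sum below mixes +oo and -oo when V and X are entrywise nonnegative. *)
Definition KLdiv (R : realType) (m n : nat) (V X : 'M[R]_(m, n)) : \bar R :=
  (\sum_(i < m) \sum_(j < n) ((X i j)%:E - (V i j)%:E * lne (X i j)%:E)
   + \sum_(i < m) \sum_(j < n) ((V i j)%:E * lne (V i j)%:E - (V i j)%:E))%E.

(* The default value 0 of the maximum is only reached when row i of V is zero,
   in which case [SN_d2 V W H i k = 0] and the entry is not updated. *)
Definition SN_c (R : realType) (m n : nat) (V : 'M[R]_(m, n)) (i : 'I_m) : R :=
  \big[Num.max/0]_(l < n | 0 < V i l) (1 / Num.sqrt (V i l)).

(* Terms with [V i l = 0] vanish even if [(W *m H) i l = 0], as [x / 0 = 0]. *)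
Definition SN_d1 (R : realType) (m n r : nat) (V : 'M[R]_(m, n))
    (W : 'M[R]_(m, r)) (H : 'M[R]_(r, n)) (i : 'I_m) (k : 'I_r) : R :=
  \sum_(l < n) H k l - \sum_(l < n) V i l * (H k l / (W *m H) i l).

Definition SN_d2 (R : realType) (m n r : nat) (V : 'M[R]_(m, n))
    (W : 'M[R]_(m, r)) (H : 'M[R]_(r, n)) (i : 'I_m) (k : 'I_r) : R :=
  \sum_(l < n) V i l * (H k l ^+ 2 / (W *m H) i l ^+ 2).

(* The constant 0.683802, split to keep the numerals small. *)
Definition SN_threshold (R : realType) : R := (683 * 10 ^+ 3 + 802) / 10 ^+ 6.

Definition SN_update (R : realType) (m n r : nat) (V : 'M[R]_(m, n))
    (W : 'M[R]_(m, r)) (H : 'M[R]_(r, n)) (i : 'I_m) (k : 'I_r) : R :=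
  let f1 := SN_d1 V W H i k in
  let f2 := SN_d2 V W H i k in
  let s := Num.max (W i k - f1 / f2) 0 in
  let d := s - W i k in
  let lambda := SN_c V i * Num.sqrt f2 * `|d| in
  if (f1 <= 0) || (lambda <= SN_threshold R) then s
  else W i k + 1 / (1 + lambda) * d.

Definition set_entry (R : realType) (p q : nat) (A : 'M[R]_(p, q))
    (i : 'I_p) (j : 'I_q) (x : R) : 'M[R]_(p, q) :=
  \matrix_(a, b) (if (a == i) && (b == j) then x else A a b).

Inductive SN_step (R : realType) (m n r : nat) (V : 'M[R]_(m, n))
    (W : 'M[R]_(m, r)) (H : 'M[R]_(r, n)) :
    'M[R]_(m, r) -> 'M[R]_(r, n) -> Prop :=
| SN_step_W (i : 'I_m) (k : 'I_r) :
    0 < SN_d2 V W H i k ->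
    SN_step V W H (set_entry W i k (SN_update V W H i k)) H
| SN_step_H (k : 'I_r) (j : 'I_n) :
    0 < SN_d2 V^T H^T W^T j k ->
    SN_step V W H W (set_entry H k j (SN_update V^T H^T W^T j k)).

(* The iterates of the algorithm; the order in which entries are visited, and
   the number of consecutive updates of an entry, are left unconstrained. *)
Inductive SN_iterate (R : realType) (m n r : nat) (V : 'M[R]_(m, n)) :
    'M[R]_(m, r) -> 'M[R]_(r, n) -> Prop :=
| SN_init (W : 'M[R]_(m, r)) (H : 'M[R]_(r, n)) :
    (forall i k, 0 < W i k) -> (forall k j, 0 < H k j) -> SN_iterate V W H
| SN_next (W W' : 'M[R]_(m, r)) (H H' : 'M[R]_(r, n)) :
    SN_iterate V W H -> SN_step V W H W' H' -> SN_iterate V W' H'.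

(* Main.v *)
Require Import Defs.
From mathcomp Require Import all_boot all_order all_algebra.
From mathcomp Require Import all_classical all_reals all_analysis.
From mathcomp Require Import ring lra.
Set Implicit Arguments.
Unset Strict Implicit.
Unset Printing Implicit Defensive.
Import Order.TTheory GRing.Theory Num.Theory.
Local Open Scope ring_scope.

(* Let [e] be the change of the updated entry, [f1], [f2] the first two
   derivatives of the objective in it, and [u_l] the relative derivative of the
   l-th entry of the updated row of [WH].  A bound
   [ln (1 + e u_l) >= e u_l - K u_l^2], summed with weights [V_il], shows that
   the objective grows by at most [e f1 + K f2], which is nonpositive for each
   step, with [K = e^2] for a full step and [K = d^2 / (1 + lambda)] for a damped
   one.  The bound for a full step is [ln (1 + z) >= z - z^2]: it holds for all
   [z >= 0] (the case [f1 <= 0]) and down to the root -0.68380... of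
   [ln (1 + z) = z - z^2], of which 0.683802 is a truncation; for [f1 > 0], the
   choice of [c] ensures [|d| u_l <= lambda] whenever [V_il > 0]. *)

(** * Lower bounds for the logarithm near 1 *)

Lemma expR_ge_partial_sum (R : realType) (x : R) (n : nat) :
  0 <= x -> \sum_(i < n) x ^+ i / i`!%:R <= expR x.
Proof.
move=> x0; rewrite -(big_mkord xpredT (fun i => x ^+ i / i`!%:R)).
apply: (nondecreasing_cvgn_le _ (is_cvg_series_exp_coeff x) n).
by apply/nondecreasing_seqP => k; rewrite /series/= big_nat_recr//= lerDl exp_coeff_ge0.
Qed.

(** After exponentiation, truncating the series of [expR] leaves a comparison of rationals. *)
Lemma ln1B_ge_threshold (R : realType) :
  - SN_threshold R - SN_threshold R ^+ 2 <= ln (1 - SN_threshold R).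
Proof.
set t := SN_threshold R.
have t1 : 0 < 1 - t by rewrite /t /SN_threshold; lra.
have t0 : 0 < t by rewrite /t /SN_threshold; lra.
rewrite -ler_expR lnK ?posrE//.
have -> : - t - t ^+ 2 = - (t + t ^+ 2) by ring.
rewrite expRN invf_ple ?posrE ?expR_gt0//.
(* Ten terms are needed: the threshold is within 10^-6 of the root. *)
apply: le_trans (expR_ge_partial_sum 10 _); last by rewrite addr_ge0 ?sqr_ge0 ?ltW.
rewrite -(ler_pM2l t1) mulfV ?gt_eqF//.
rewrite !big_ord_recr big_ord0 /= !factS fact0 !natrM /t /SN_threshold.
lra.
Qed.

Lemma ln_ge_sub_inv (R : realType) (x : R) : 0 < x -> 1 - x^-1 <= ln x.
Proof.
move=> x0; have xV0 : 0 < x^-1 by rewrite invr_gt0.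
have : ln (1 + (x^-1 - 1)) <= x^-1 - 1 by apply: le_ln1Dx; lra.
rewrite (_ : 1 + (_ - 1) = x^-1); last by ring.
by rewrite lnV ?posrE//; lra.
Qed.

Lemma ln1B_ge_small (R : realType) (x : R) :
  0 <= x -> x <= 3 / 5 -> - x - x ^+ 2 <= ln (1 - x).
Proof.
move=> x0 x35; have x1 : 0 < 1 - x by lra.
rewrite -ler_expR lnK ?posrE//.
have -> : - x - x ^+ 2 = - (x + x ^+ 2) by ring.
rewrite expRN invf_ple ?posrE ?expR_gt0//.
apply: le_trans (expR_ge_partial_sum 4 _); last by rewrite addr_ge0 ?sqr_ge0.
rewrite -(ler_pM2l x1) mulfV ?gt_eqF//.
rewrite !big_ord_recr big_ord0 /= !factS fact0 !natrM.
have x2 : x ^+ 2 <= (3 / 5) ^+ 2 by rewrite lerXn2r ?nnegrE//; lra.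
have x3 : x ^+ 3 <= (3 / 5) ^+ 3 by rewrite lerXn2r ?nnegrE//; lra.
have x4 : x ^+ 4 <= (3 / 5) ^+ 4 by rewrite lerXn2r ?nnegrE//; lra.
have x5 : x ^+ 5 <= (3 / 5) ^+ 5 by rewrite lerXn2r ?nnegrE//; lra.
(* This product is exactly [(1 - x) * P (x + x ^+ 2) - 1], with [P] the cubic Taylor polynomial of
   the exponential. *)
have : 0 <= x ^+ 2 * (1 / 2 - x / 3 - x ^+ 2 / 6 - x ^+ 3 / 2 - x ^+ 4 / 3 - x ^+ 5 / 6).
  by rewrite mulr_ge0 ?sqr_ge0//; lra.
lra.
Qed.

Lemma ln1B_ge (R : realType) (x : R) :
  0 <= x -> x <= SN_threshold R -> - x - x ^+ 2 <= ln (1 - x).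
Proof.
move=> x0 xt; have [x35|x35] := leP x (3 / 5).
  exact: ln1B_ge_small.
have := ln1B_ge_threshold R; set t := SN_threshold R in xt * => lnt.
have t1 : 0 < 1 - t by rewrite /t /SN_threshold; lra.
have tlt : t < 7 / 10 by rewrite /t /SN_threshold; lra.
have x1 : 0 < 1 - x by lra.
(* Comparison with the endpoint [t] through [ln z >= 1 - 1 / z], which is sharp
   enough as [t (1 - x) <= x^2]. *)
have -> : 1 - x = (1 - t) * ((1 - x) / (1 - t)) by field; rewrite gt_eqF.
rewrite lnM ?posrE ?divr_gt0//.
have : 1 - ((1 - x) / (1 - t))^-1 <= ln ((1 - x) / (1 - t)).
  by rewrite ln_ge_sub_inv ?divr_gt0.
have -> : 1 - ((1 - x) / (1 - t))^-1 = (t - x) / (1 - x).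
  by field; rewrite !gt_eqF.
(* The left side is [- x - x ^+ 2] minus its value at [t]. *)
have : (t - x) * (1 + t + x) <= (t - x) / (1 - x).
  rewrite ler_wpM2l ?subr_ge0// -(ler_pM2r x1) mulVf ?gt_eqF//.
  have : (3 / 5) ^+ 2 <= x ^+ 2 by rewrite lerXn2r ?nnegrE; lra.
  have : t * (1 - x) <= 7 / 10 * (2 / 5) by rewrite ler_pM; lra.
  by lra.
by lra.
Qed.

Lemma ln1D_ge (R : realType) (x : R) :
  - SN_threshold R <= x -> x - x ^+ 2 <= ln (1 + x).
Proof.
move=> tx; have [x0|x0] := leP 0 x.
  have x1 : 0 < 1 + x by lra.
  apply: le_trans (ln_ge_sub_inv x1).
  have -> : 1 - (1 + x)^-1 = x / (1 + x) by field; rewrite gt_eqF.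
  rewrite ler_pdivlMr//.
  have : 0 <= x ^+ 3 by rewrite exprn_ge0.
  by lra.
have := @ln1B_ge R (- x); rewrite sqrrN !opprK; apply; lra.
Qed.

(** By [ln z >= 1 - 1 / z], it suffices that [1 + L <= (1 + u) * (1 + L - u)], that is,
    [0 <= u * (L - u)]. Damping thus allows arbitrarily large [L]. *)
Lemma ln1B_damped_ge (R : realType) (u L : R) : 0 <= u -> u <= L ->
  - (u / (1 + L)) - u ^+ 2 / (1 + L) <= ln (1 - u / (1 + L)).
Proof.
move=> u0 uL.
have L1 : 0 < 1 + L by lra.
have Lu : 0 < 1 + L - u by lra.
have y0 : 0 < 1 - u / (1 + L) by rewrite subr_gt0 ltr_pdivrMr//; lra.
apply: le_trans (ln_ge_sub_inv y0).
have -> : 1 - (1 - u / (1 + L))^-1 = - (u / (1 + L - u)).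
  by field; rewrite !gt_eqF.
rewrite -opprD lerN2 -mulrDl ler_pdivrMr// mulrAC ler_pdivlMr//.
have : 0 <= u ^+ 2 * (L - u) by rewrite mulr_ge0 ?sqr_ge0 ?subr_ge0.
by lra.
Qed.

(** * Descent on one row of the divergence *)

(* No bound on [y] is needed when some [v l > 0] has [x l = 0]: the right-hand
   side is then [+oo]. *)
Lemma le_KL_row (R : realType) (n : nat) (v x y : 'I_n -> R) :
  (forall l, 0 <= v l) -> (forall l, 0 <= x l) ->
  ((forall l, 0 < v l -> 0 < x l) ->
    (forall l, 0 < v l -> 0 < y l) /\
    \sum_l (y l - v l * ln (y l)) <= \sum_l (x l - v l * ln (x l))) ->
  (\sum_l ((y l)%:E - (v l)%:E * lne (y l)%:E) <=
   \sum_l ((x l)%:E - (v l)%:E * lne (x l)%:E))%E.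
Proof.
move=> v0 x0 yx.
have finE z : (forall l, 0 < v l -> 0 < z l) ->
    (\sum_l ((z l)%:E - (v l)%:E * lne (z l)%:E))%E
    = (\sum_l (z l - v l * ln (z l)))%:E.
  move=> z0; rewrite -sumEFin; apply: eq_bigr => l _.
  have [vl0|vl0] := eqVneq (v l) 0; first by rewrite vl0 mul0e mul0r sube0 subr0.
  by rewrite lne_EFin ?z0// lt_def vl0 v0.
have [xpos|] := pselect (forall l, 0 < v l -> 0 < x l).
  by have [ypos le_yx] := yx xpos; rewrite !finE// lee_fin.
move=> /existsNP[l /not_implyP[vl0 /negP]]; rewrite -leNgt => xl0.
(* The [l]-th term is [+oo], and it decides the sum once no term is [-oo]. *)
have term_gtNy i : ((x i)%:E - (v i)%:E * lne (x i)%:E != -oo)%E.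
  have [xi0|xi0] := leP (x i) 0; last by rewrite lne_EFin.
  have [vi0|vi0] := eqVneq (v i) 0; first by rewrite vi0 mul0e sube0.
  by rewrite le0_lneNy ?lee_fin// gt0_muleNy// lte_fin lt_def vi0 v0.
suff -> : (\sum_l ((x l)%:E - (v l)%:E * lne (x l)%:E) = +oo)%E by rewrite leey.
apply/esum_eqyP => //; exists l; split=> //.
by rewrite le0_lneNy ?lee_fin// gt0_muleNy// lte_fin.
Qed.

(** Factoring out [x l] splits the logarithm and cancels [ln (x l)]: with [u = h l / x l], a term
    with [v l > 0] changes by [e * h l - v l * ln (1 + e * u)]. *)
Lemma KL_row_descent (R : realType) (n : nat) (v x h : 'I_n -> R) (e K : R) :
  (forall l, 0 <= v l) -> (forall l, 0 < v l -> 0 < x l) ->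
  (forall l, 0 < v l -> 0 < 1 + e * (h l / x l) /\
    e * (h l / x l) - K * (h l / x l) ^+ 2 <= ln (1 + e * (h l / x l))) ->
  e * (\sum_l h l - \sum_l v l * (h l / x l))
    + K * \sum_l v l * (h l ^+ 2 / x l ^+ 2) <= 0 ->
  (forall l, 0 < v l -> 0 < x l + e * h l) /\
  \sum_l (x l + e * h l - v l * ln (x l + e * h l))
    <= \sum_l (x l - v l * ln (x l)).
Proof.
move=> v0 xpos lnb dec.
have fact l : 0 < v l -> x l + e * h l = x l * (1 + e * (h l / x l)).
  by move=> vl; field; rewrite gt_eqF ?xpos.
have pos l : 0 < v l -> 0 < x l + e * h l.
  by move=> vl; rewrite fact// mulr_gt0 ?xpos//; case: (lnb l vl).
split=> //; rewrite -subr_le0; apply: le_trans dec.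
rewrite mulrBr !mulr_sumr -!sumrB -big_split/=; apply: ler_sum => l _.
have [vl0|vl0] := eqVneq (v l) 0.
  by rewrite vl0 !mul0r !mulr0 !subr0 addr0 addrC addKr.
have vl : 0 < v l by rewrite lt_def vl0 v0.
have [u1 u2] := lnb _ vl.
rewrite fact// lnM ?posrE ?xpos// -fact// -expr_div_n.
have : v l * (e * (h l / x l) - K * (h l / x l) ^+ 2)
    <= v l * ln (1 + e * (h l / x l)) by rewrite ler_wpM2l.
by lra.
Qed.

(** * Entry replacement, transposition and signs *)

Lemma set_entry_mulmx (R : realType) (m n r : nat) (W : 'M[R]_(m, r))
    (H : 'M[R]_(r, n)) i k w a l :
  (set_entry W i k w *m H) a l
  = (W *m H) a l + (if a == i then (w - W i k) * H k l else 0).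
Proof.
rewrite !mxE (bigD1 k)//= [in RHS](bigD1 k)//= !mxE eqxx andbT.
rewrite (eq_bigr (fun j => W a j * H j l)); last first.
  by move=> j /negbTE jk; rewrite !mxE jk andbF.
by case: eqP => [->|_]; [ring|rewrite addr0].
Qed.

Lemma set_entry_tr (R : realType) (p q : nat) (A : 'M[R]_(p, q)) i j x :
  set_entry A i j x = (set_entry A^T j i x)^T.
Proof. by apply/matrixP => a b; rewrite !mxE andbC. Qed.

Lemma set_entry_ge0 (R : realType) (p q : nat) (A : 'M[R]_(p, q)) i j x :
  (forall a b, 0 <= A a b) -> 0 <= x -> forall a b, 0 <= set_entry A i j x a b.
Proof. by move=> A0 x0 a b; rewrite mxE; case: ifP. Qed.

Lemma KLdiv_tr (R : realType) (m n : nat) (V X : 'M[R]_(m, n)) :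
  KLdiv V^T X^T = KLdiv V X.
Proof.
rewrite /KLdiv exchange_big/= [X in (_ + X)%E]exchange_big/=.
by congr (_ + _)%E; apply: eq_bigr => i _; apply: eq_bigr => j _; rewrite !mxE.
Qed.

Lemma SN_c_ge0 (R : realType) (m n : nat) (V : 'M[R]_(m, n)) i : 0 <= SN_c V i.
Proof. exact: bigmax_ge_id. Qed.

(** The full step is clipped at 0, and the damped one is a convex combination of [W i k] and the
    clipped point. *)
Lemma SN_update_ge0 (R : realType) (m n r : nat) (V : 'M[R]_(m, n))
    (W : 'M[R]_(m, r)) (H : 'M[R]_(r, n)) i k :
  0 <= W i k -> 0 <= SN_update V W H i k.
Proof.
move=> w0; rewrite /SN_update; set s := Num.max _ _; set L := _ * `|_|.
have s0 : 0 <= s by rewrite le_max lexx orbT.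
have L0 : 0 <= L by rewrite !mulr_ge0 ?SN_c_ge0.
case: ifP => // _.
have -> : W i k + 1 / (1 + L) * (s - W i k) = (L * W i k + s) / (1 + L).
  by field; rewrite gt_eqF// ltr_pwDl.
by rewrite divr_ge0 ?addr_ge0// mulr_ge0.
Qed.

(** * Descent for one update of [W] *)

Section SN_update.
Context (R : realType) (m n r : nat) (V : 'M[R]_(m, n)).
Context (W : 'M[R]_(m, r)) (H : 'M[R]_(r, n)) (i : 'I_m) (k : 'I_r).
Context (V_ge0 : forall a b, 0 <= V a b) (W_ge0 : forall a b, 0 <= W a b).
Context (H_ge0 : forall a b, 0 <= H a b) (d2_gt0 : 0 < SN_d2 V W H i k).

Lemma mulmx_ge0 a l : 0 <= (W *m H) a l.
Proof. by rewrite mxE sumr_ge0// => j _; rewrite mulr_ge0. Qed.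

(** [SN_d2] dominates its [l]-th term [V i l * u ^+ 2], where [u] is the ratio, and [SN_c] dominates
    [1 / Num.sqrt (V i l)]. *)
Lemma ratio_le_SN_lambda l t : 0 < V i l -> 0 <= t ->
  t * (H k l / (W *m H) i l) <= SN_c V i * Num.sqrt (SN_d2 V W H i k) * t.
Proof.
move=> vl t0; rewrite mulrC ler_wpM2r//.
have u0 : 0 <= H k l / (W *m H) i l by rewrite divr_ge0 ?mulmx_ge0.
have vs : 0 < Num.sqrt (V i l) by rewrite sqrtr_gt0.
have -> : H k l / (W *m H) i l
    = 1 / Num.sqrt (V i l) * Num.sqrt (V i l * (H k l / (W *m H) i l) ^+ 2).
  by rewrite sqrtrM ?V_ge0// sqrtr_sqr ger0_norm// mulrA div1r mulVf ?gt_eqF// mul1r.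
apply: ler_pM; rewrite ?sqrtr_ge0 ?divr_ge0//.
  exact: (le_bigmax_cond 0 (fun l => 1 / Num.sqrt (V i l))).
rewrite ler_wsqrtr// expr_div_n /SN_d2 (bigD1 l)//= lerDl sumr_ge0// => j _.
by rewrite mulr_ge0 ?divr_ge0 ?sqr_ge0.
Qed.

Lemma SN_update_descent (e := SN_update V W H i k - W i k) :
  exists K, e * SN_d1 V W H i k + K * SN_d2 V W H i k <= 0 /\
  forall l, 0 < V i l ->
    0 < 1 + e * (H k l / (W *m H) i l) /\
    e * (H k l / (W *m H) i l) - K * (H k l / (W *m H) i l) ^+ 2
      <= ln (1 + e * (H k l / (W *m H) i l)).
Proof.
rewrite {}/e /SN_update.
have ratio_le := ratio_le_SN_lambda; have f2_gt0 := d2_gt0.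
set f1 := SN_d1 V W H i k; set f2 := SN_d2 V W H i k in f2_gt0 ratio_le *.
set w := W i k; set s := Num.max _ _; set L := _ * `|_|.
have w0 : 0 <= w by exact: W_ge0.
have u0 l : 0 <= H k l / (W *m H) i l by rewrite divr_ge0 ?mulmx_ge0.
have thr1 : SN_threshold R < 1 by rewrite /SN_threshold; lra.
have thr0 : 0 < SN_threshold R by rewrite /SN_threshold; lra.
have [f1_le0|f1_gt0] := leP f1 0 => /=.
  have q0 : f1 / f2 <= 0 by rewrite ler_pdivrMr// mul0r.
  have -> : s = w - f1 / f2 by rewrite /s max_l//; lra.
  (* The Newton step is not clipped here, so [e * f1] and [K * f2] cancel exactly. *)
  exists ((f1 / f2) ^+ 2); split.
    rewrite le_eqVlt; apply/orP; left; apply/eqP.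
    by field; rewrite gt_eqF.
  move=> l vl; set u := H k l / _; rewrite (_ : w - f1 / f2 - w = - (f1 / f2)); last by ring.
  have eu : 0 <= - (f1 / f2) * u by rewrite mulr_ge0 ?oppr_ge0 ?u0.
  split; first by lra.
  by have := @ln1D_ge R (- (f1 / f2) * u); rewrite exprMn sqrrN; apply; lra.
have t0 : 0 <= w - s.
  by rewrite subr_ge0 ge_max w0 lerBlDr lerDl divr_ge0// ltW.
(* Clipping can only shorten the decrease [f1 / f2]. *)
have tf : (w - s) * f2 <= f1.
  by rewrite -ler_pdivlMr// lerBlDr addrC -lerBlDr le_max lexx.
have LE : L = SN_c V i * Num.sqrt f2 * (w - s).
  by rewrite /L distrC ger0_norm.
have L0 : 0 <= L by rewrite LE !mulr_ge0 ?SN_c_ge0 ?sqrtr_ge0.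
have tu l : 0 < V i l -> (w - s) * (H k l / (W *m H) i l) <= L.
  by move=> vl; rewrite LE ratio_le.
have [Lle|Lgt] := leP L (SN_threshold R).
  exists ((w - s) ^+ 2); split.
    have -> : (s - w) * f1 + (w - s) ^+ 2 * f2 = (w - s) * ((w - s) * f2 - f1).
      by ring.
    by rewrite mulr_ge0_le0// subr_le0.
  move=> l vl; set u := H k l / _; have := tu l vl; rewrite -/u => tul.
  split; first by lra.
  have := @ln1D_ge R ((s - w) * u); rewrite exprMn -sqrrN opprB; apply; lra.
exists ((w - s) ^+ 2 / (1 + L)).
have L1 : 0 < 1 + L by lra.
rewrite (_ : w + 1 / (1 + L) * (s - w) - w = - ((w - s) / (1 + L))); last first.
  by field; rewrite gt_eqF.
split.
  (* Both terms carry the same factor [1 / (1 + L)], so the sign is that of the full step. *)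
  have -> : - ((w - s) / (1 + L)) * f1 + (w - s) ^+ 2 / (1 + L) * f2
      = (w - s) / (1 + L) * ((w - s) * f2 - f1) by field; rewrite gt_eqF.
  by rewrite mulr_ge0_le0 ?subr_le0// divr_ge0// ltW.
move=> l vl; set u := H k l / _; have := tu l vl; rewrite -/u => tul.
have tu0 : 0 <= (w - s) * u by rewrite mulr_ge0 ?u0.
have -> : - ((w - s) / (1 + L)) * u = - ((w - s) * u / (1 + L)) by ring.
split; first by rewrite subr_gt0 ltr_pdivrMr//; lra.
have -> : (w - s) ^+ 2 / (1 + L) * u ^+ 2 = ((w - s) * u) ^+ 2 / (1 + L) by ring.
exact: ln1B_damped_ge.
Qed.

Lemma KLdiv_SN_update :
  (KLdiv V (set_entry W i k (SN_update V W H i k) *m H) <= KLdiv V (W *m H))%E.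
Proof.
rewrite /KLdiv leeD2r// lee_sum// => a _.
have [->{a}|ai] := eqVneq a i; last first.
  by apply: lee_sum => l _; rewrite set_entry_mulmx (negbTE ai) addr0.
apply: le_KL_row => // [l|xpos]; first exact: mulmx_ge0.
have [K [dec lnb]] := SN_update_descent.
have [] := @KL_row_descent R n (V i) ((W *m H) i) (H k) _ K (V_ge0 i) xpos lnb dec.
set e := _ - _ => pos sums.
have yE l : (set_entry W i k (SN_update V W H i k) *m H) i l
    = (W *m H) i l + e * H k l by rewrite set_entry_mulmx eqxx.
split=> [l vl|]; first by rewrite yE pos.
by under eq_bigr do rewrite yE.
Qed.

End SN_update.

(** Strict positivity is not invariant, since a full step may land on 0. *)
Lemma SN_iterate_ge0 (R : realType) (m n r : nat) (V : 'M[R]_(m, n))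
    (W : 'M[R]_(m, r)) (H : 'M[R]_(r, n)) : SN_iterate V W H ->
  (forall i k, 0 <= W i k) /\ (forall k j, 0 <= H k j).
Proof.
elim=> [{}W {}H W0 H0|{}W W' {}H H' _ [W0 H0] step].
  by split=> *; rewrite ltW.
case: step => [i k _|k j _]; split=> //; apply: set_entry_ge0 => //.
- exact: SN_update_ge0.
- by apply: SN_update_ge0; rewrite mxE.
Qed.

Theorem proposition9 (R : realType) (m n r : nat) (V : 'M[R]_(m, n))
    (V_ge0 : forall i j, 0 <= V i j)
    (W W' : 'M[R]_(m, r)) (H H' : 'M[R]_(r, n)) :
  SN_iterate V W H -> SN_step V W H W' H' ->
  (KLdiv V (W' *m H') <= KLdiv V (W *m H))%E.
Proof.
move=> /SN_iterate_ge0[W0 H0] [i k f2|k j f2]; first exact: KLdiv_SN_update.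
(* Transposition turns an update of [H] into one of the left factor. *)
rewrite -KLdiv_tr -[leRHS]KLdiv_tr !trmx_mul set_entry_tr trmxK.
by apply: KLdiv_SN_update => // a b; rewrite mxE.
Qed.
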